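(* Let $N\ge 1$, let $V$, $\Delta$, $\mathcal F$, $T_v$, $\mathcal W$, $s_0$, $\{x_1,\dots,x_N\}$, $\mathcal H_\Omega$ and $\mathcal H_{i_1\dots i_n}$ be as in the context. Then: (i) The subspaces $\mathcal H_\Omega$ and $\mathcal H_{i_1\dots i_n}$ ($n\ge1$, $i_1,\dots,i_n\in\{1,\dots,N\}$, $i_n\neq 1$) are mutually orthogonal, $$\mathcal H_\Omega\oplus\bigoplus_{n\ge1,\ i_1,\dots,i_n\in\{1,\dots,N\},\ i_n\neq1}\mathcal H_{i_1\dots i_n}=\mathcal F,$$ and each of them is a cyclic subspace for the operator $\mathcal W\Delta\mathcal W^*$. (ii) Let $S$ be the unilateral shift on $l^2(\mathbb{N}_0)$, $S(y_0,y_1,y_2,\dots)=(0,y_0,y_1,\dots)$, let $\operatorname{Re}S=\frac{S+S^*}{2}$ and let $P_{\delta_0}$ be the orthogonal projection onto $\delta_0$. The restriction of $\mathcal W\Delta\mathcal W^*$ to $\mathcal H_\Omega$ is unitarily equivalent to $D_\Omega:=(N+1)I-2\sqrt N\operatorname{Re}S-P_{\delta_0}$ on $l^2(\mathbb{N}_0)$, and for all $n\ge1$ and $i_1,\dots,i_n\in\{1,\dots,N\}$ with $i_n\neq1$, the restriction of $\mathcal W\Delta\mathcal W^*$ to $\mathcal H_{i_1\dots i_n}$ is unitarily equivalent to $D:=(N+1)I-2\sqrt N\operatorname{Re}S$ on $l^2(\mathbb{N}_0)$.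
   Context: $V$ is the set of finite words over $\{1,\dots,N\}$ including the empty word $\emptyset$; the $N$-ary tree has edges exactly the pairs $\{\omega,\omega i\}$ ($\omega\in V$, $i\in\{1,\dots,N\}$, $\omega i$ = $\omega$ with letter $i$ appended). $\Delta$ is the graph Laplacian $(\Delta v)(x)=\sum_{y\sim x}(v(x)-v(y))$ on $l^2(V)$ (bounded selfadjoint). Let $H=\mathbb{C}^N$ with orthonormal basis $e_1,\dots,e_N$, and let $\mathcal F=\mathbb{C}\Omega\oplus H\oplus H^{\otimes 2}\oplus\cdots$ be the full Fock space (Hilbert direct sum, $\Omega$ a unit vector). For $v\in H$ let $T_v$ on $\mathcal F$ be $T_v\Omega=v$, $T_v\xi=\xi\otimes v$ for $\xi\in H^{\otimes n}$, $n\ge1$. Let $\mathcal W:l^2(V)\to\mathcal F$ be the unitary with $\mathcal W\delta_\emptyset=\Omega$ and $\mathcal W\delta_{\omega_1\dots\omega_n}=e_{\omega_1}\otimes\cdots\otimes e_{\omega_n}$. Let $s_0=N^{-1/2}\sum_{i=1}^Ne_i$ and let $\{x_1,\dots,x_N\}$ be an orthonormal basis of $H$ with $x_1=s_0$. Define $\mathcal H_\Omega=\overline{\operatorname{span}}\{\Omega,\ s_0^{\otimes p}: p\ge1\}$ and, for $n\ge1$, $i_1,\dots,i_n\in\{1,\dots,N\}$ with $i_n\neq1$, $\mathcal H_{i_1\dots i_n}=\overline{\operatorname{span}}\{x_{i_1}\otimes\cdots\otimes x_{i_n}\otimes s_0^{\otimes p}: p\ge0\}$. *)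

(* Defs.v *)
From HB Require Import structures.
From mathcomp Require Import all_boot all_order all_algebra.
From mathcomp Require Import complex.
From mathcomp Require Import all_classical all_reals.
From mathcomp Require Import esum.
Set Implicit Arguments. Unset Strict Implicit. Unset Printing Implicit Defensive.
Import Order.TTheory GRing.Theory Num.Theory.
Local Open Scope ring_scope.
Local Open Scope classical_set_scope.
Local Open Scope complex_scope.

Section Defs.
Variable R : realType.
Local Notation C := (R[i]).

(** squared modulus |z|^2 *)
Definition nsq (z : C) : R := complex.Re z ^+ 2 + complex.Im z ^+ 2.

(** squared l^2 norm of a function on a countable index type (extended real) *)
Definition norm2 {T : choiceType} (f : T -> C) : \bar R :=
  \esum_(w in [set: T]) (nsq (f w))%:E.

Definition l2 {T : choiceType} (f : T -> C) : Prop := (norm2 f < +oo)%E.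

(** sum of an absolutely summable real family: positive part minus negative part *)
Definition rsum {T : choiceType} (u : T -> R) : R :=
  fine (\esum_(w in [set: T]) (Num.max (u w) 0)%:E)
  - fine (\esum_(w in [set: T]) (Num.max (- u w) 0)%:E).

(** inner product <f, g> = sum_w f(w) * conj (g w) *)
Definition inner {T : choiceType} (f g : T -> C) : C :=
  (rsum (fun w => complex.Re (f w * (g w)^*))) +i* (rsum (fun w => complex.Im (f w * (g w)^*))).

(** linear span (finite linear combinations) *)
Definition lspan {T : choiceType} (A : set (T -> C)) : set (T -> C) :=
  [set h | exists s : seq ((T -> C) * C),
      (forall p, p \in s -> A p.1) /\ h = (fun w => \sum_(p <- s) p.2 * p.1 w)].

(** closed linear span in l^2(T) *)
Definition cspan {T : choiceType} (A : set (T -> C)) : set (T -> C) :=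
  [set g | l2 g /\ forall e : R, 0 < e ->
      exists h, lspan A h /\ (norm2 (fun w => (g w - h w)%R) < e%:E)%E].

(** M is a cyclic subspace for the operator A *)
Definition cyclic_subspace {T : choiceType} (A : (T -> C) -> (T -> C))
  (M : set (T -> C)) : Prop :=
  exists xi, M xi /\ M = cspan [set iter k A xi | k in [set: nat]].

(** the restriction of A to the (invariant) subspace M is unitarily equivalent
    to the operator B on l^2(T') *)
Definition unit_equiv_restr {T T' : choiceType} (A : (T -> C) -> (T -> C))
  (M : set (T -> C)) (B : (T' -> C) -> (T' -> C)) : Prop :=
  exists U : (T -> C) -> (T' -> C),
    [/\ (forall f, M f -> l2 (U f) /\ norm2 (U f) = norm2 f),
        (forall a f g, M f -> M g ->
           U (fun w => a * f w + g w) = (fun w => a * U f w + U g w)),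
        (forall y, l2 y -> exists2 f, M f & U f = y)
      & (forall f, M f -> M (A f) /\ U (A f) = B (U f))].

Variable N : nat.
Notation word := (seq 'I_N).

(** graph Laplacian of the N-ary tree on functions V -> C;
    neighbours of w: the children rcons w i, and the parent (if w <> [::]) *)
Definition parent (w : word) : word := take (size w).-1 w.
Definition Delta (v : word -> C) : word -> C := fun w =>
  \sum_(i < N) (v w - v (rcons w i))
  + (if w is [::] then 0 else v w - v (parent w)).

(** Concrete model of the full Fock space over H = C^N: H^{(x) n} is identified
    with C^{'I_N^n} (the tensor e_{i1} (x) ... (x) e_{in} being the indicator of
    the word i1...in), so F = l^2(words). *)
Definition vecH := 'I_N -> C.
Definition tens (vs : seq vecH) : word -> C := fun w =>
  if size w == size vs then \prod_(p <- zip vs w) p.1 p.2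
  else 0.
Definition Omega : word -> C := fun w => if w == [::] then 1 else 0.
Definition ebasis (i : 'I_N) : vecH := fun j => (i == j)%:R.

(** The unitary W : l^2(V) -> F, W delta_w = e_{w1} (x) ... (x) e_{wn}
    (= tens (map ebasis w)); in the above model of F this is
    f |-> (w |-> f w), and W^* is its inverse. *)
Definition W (f : word -> C) : word -> C := fun w => f w.
Definition Wadj (f : word -> C) : word -> C := fun w => f w.
Definition WDeltaW (f : word -> C) : word -> C := W (Delta (Wadj f)).

Definition s0 : vecH := fun _ => ((Num.sqrt (N%:R : R))^-1)%:C.

Definition inner_H (u v : vecH) : C := \sum_(j < N) u j * (v j)^*.

Definition H_Omega : set (word -> C) :=
  cspan ([set Omega] `|` [set tens (nseq p s0) | p in [set p : nat | (0 < p)%N]]).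

Definition H_idx (x : 'I_N -> vecH) (ws : word) : set (word -> C) :=
  cspan [set tens (map x ws ++ nseq p s0) | p in [set: nat]].

(** operators on l^2(N_0) *)
Definition shiftS (y : nat -> C) : nat -> C :=
  fun k => if k is k'.+1 then y k' else 0.
Definition shiftSadj (y : nat -> C) : nat -> C := fun k => y k.+1.
Definition ReS (y : nat -> C) : nat -> C :=
  fun k => (shiftS y k + shiftSadj y k) / 2.
Definition Dop (y : nat -> C) : nat -> C :=
  fun k => (N.+1)%:R * y k - 2 * (Num.sqrt (N%:R : R))%:C * ReS y k.
Definition Proj0 (y : nat -> C) : nat -> C := fun k => if k == 0%N then y 0%N else 0.
Definition DOmega (y : nat -> C) : nat -> C := fun k => Dop y k - Proj0 y k.

End Defs.

(* Main.v *)
Require Import Defs.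
From HB Require Import structures.
From mathcomp Require Import all_boot all_order all_algebra.
From mathcomp Require Import complex.
From mathcomp Require Import all_classical all_reals.
From mathcomp Require Import esum.
From mathcomp Require Import ereal ring lra.
Import Order.TTheory GRing.Theory Num.Theory.
Local Open Scope ring_scope.
Local Open Scope classical_set_scope.
Local Open Scope complex_scope.

Set Implicit Arguments.
Unset Strict Implicit.
Unset Printing Implicit Defensive.

(** The tensors [x_u] of basis vectors along words [u] form an orthonormal basis
    of the Fock space, and every word is uniquely [ws ++ nseq p i1] with [ws]
    empty or not ending in [i1], so the basis splits into rays
    [b_p = x_ws (x) s0^p].  Along a ray the Laplacian is a Jacobi matrix: passing
    to parents multiplies by [sqrt N] and moves up the ray, while summing over
    children pairs the last tensor factor with [s0], which moves down the ray and
    kills the bottom vector.  As the vectors [b_p] of one ray live on distinct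
    levels of the tree, a member of the closed span is read off level by level
    from finite sums, and this identifies the ray space with [l^2(nat)]. *)

(** * Square-summable functions on a discrete set *)

Section SquareSummable.
Context {R : realType}.
Local Notation C := R[i].

Lemma nsq_ge0 (z : C) : 0 <= nsq z.
Proof. by rewrite addr_ge0 ?sqr_ge0. Qed.

Lemma nsq0 : nsq (0 : C) = 0.
Proof. by rewrite /nsq /= expr0n addr0. Qed.

Lemma nsqE (z : C) : (nsq z)%:C = z * z^*.
Proof. by case: z => a b; rewrite /nsq; simpc; congr (_ +i* _); ring. Qed.

Lemma nsqM (a b : C) : nsq (a * b) = nsq a * nsq b.
Proof. by case: a b => [a a'] [b b']; rewrite /nsq /=; ring. Qed.

Lemma nsq_eq0 (z : C) : nsq z = 0 -> z = 0.
Proof.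
case: z => a b /eqP; rewrite /nsq /= paddr_eq0 ?sqr_ge0// !sqrf_eq0.
by case/andP => /eqP -> /eqP ->.
Qed.

Lemma nsqD_le (a b : C) : nsq (a + b) <= 2 * nsq a + 2 * nsq b.
Proof.
case: a b => [a a'] [b b']; rewrite /nsq /= -subr_ge0.
have -> : 2 * (a ^+ 2 + a' ^+ 2) + 2 * (b ^+ 2 + b' ^+ 2)
   - ((a + b) ^+ 2 + (a' + b') ^+ 2) = (a - b) ^+ 2 + (a' - b') ^+ 2 by ring.
by rewrite addr_ge0 ?sqr_ge0.
Qed.

Lemma esum_image_le {T T' : choiceType} (e : T -> T') (a : T' -> \bar R) :
  injective e -> (forall i, 0 <= a i)%E ->
  (\esum_(i in [set: T]) a (e i) <= \esum_(j in [set: T']) a j)%E.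
Proof.
move=> inje a0; rewrite -(esum_image _ _ a); last by move=> ? ? _ _ /inje.
by rewrite esum_mkcond; apply: le_esum => i _; case: ifP.
Qed.

Lemma esum_image_eq {T T' : choiceType} (e : T -> T') (a : T' -> \bar R) :
  injective e -> (forall j, ~ range e j -> a j = 0%E) ->
  \esum_(i in [set: T]) a (e i) = \esum_(j in [set: T']) a j.
Proof.
move=> inje a0; rewrite -(esum_image _ _ a); last by move=> ? ? _ _ /inje.
rewrite esum_mkcond; apply: eq_esum => i _.
by case: ifPn => // /negP; rewrite inE => /a0 ->.
Qed.

Lemma esumZ_le {T : choiceType} (c : R) (a : T -> \bar R) :
  0 <= c -> (forall i, 0 <= a i)%E ->
  (\esum_(i in [set: T]) (c%:E * a i) <= c%:E * \esum_(i in [set: T]) a i)%E.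
Proof.
move=> c0 a0; apply: ge_ereal_sup => _ [X [finX _] <-].
rewrite -ge0_mule_fsumr//; apply: lee_wpmul2l; first by rewrite lee_fin.
by apply: ereal_sup_ubound; exists X.
Qed.

Section Norm.
Context {T : choiceType}.
Implicit Types f g : T -> C.

Lemma norm2_ge0 f : (0 <= norm2 f)%E.
Proof. by apply: esum_ge0 => ? _; rewrite lee_fin nsq_ge0. Qed.

Lemma norm2_pointwise f w : ((nsq (f w))%:E <= norm2 f)%E.
Proof.
rewrite -(@esum_set1 _ _ w (fun w => (nsq (f w))%:E)) ?lee_fin ?nsq_ge0//.
rewrite esum_mkcond; apply: le_esum => i _.
by case: ifP => // _; rewrite lee_fin nsq_ge0.
Qed.

Lemma norm2_0 : norm2 (fun _ : T => 0 : C) = 0%E.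
Proof. by apply: esum1 => ? _; rewrite nsq0. Qed.

Lemma l2_combo (a : C) f g : l2 f -> l2 g -> l2 (fun w => a * f w + g w).
Proof.
move=> l2f l2g; rewrite /l2 /norm2.
pose F w := (nsq (f w))%:E : \bar R; pose G w := (nsq (g w))%:E : \bar R.
have F0 w : (0 <= F w)%E by rewrite lee_fin nsq_ge0.
have G0 w : (0 <= G w)%E by rewrite lee_fin nsq_ge0.
have a0 : 0 <= 2 * nsq a by rewrite mulr_ge0 ?nsq_ge0.
apply: (@le_lt_trans _ _
  (\esum_(w in [set: T]) ((2 * nsq a)%:E * F w + 2%:E * G w))%E).
  apply: le_esum => w _; rewrite -!EFinM -EFinD lee_fin.
  by apply: le_trans (nsqD_le _ _) _; rewrite nsqM mulrA.
rewrite esumD => [|i _|i _]; first last.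
- by apply: mule_ge0 => //; rewrite lee_fin.
- by apply: mule_ge0 => //; rewrite lee_fin.
apply: (@le_lt_trans _ _ ((2 * nsq a)%:E * norm2 f + 2%:E * norm2 g)%E).
  by apply: leeD; apply: esumZ_le.
by apply: lte_add_pinfty; apply: lte_mul_pinfty => //; rewrite lee_fin.
Qed.

Lemma l2_0 : l2 (fun _ : T => 0 : C).
Proof. by rewrite /l2 norm2_0. Qed.

Lemma l2Z (a : C) f : l2 f -> l2 (fun w => a * f w).
Proof.
move=> l2f; rewrite (_ : (fun w => _) = (fun w => a * f w + 0)).
  exact: l2_combo l2f l2_0.
by apply/funext => w; rewrite addr0.
Qed.

(** The squared norm is a supremum of sums over finite sets; a set that comes within [e] of it
    leaves a tail below [e]. *)
Lemma l2_finite_approx f (e : R) : l2 f -> 0 < e ->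
  exists2 s : seq T, uniq s
    & (norm2 (fun w => (f w - (if w \in s then f w else 0))%R) < e%:E)%E.
Proof.
move=> l2f e0; pose F w := (nsq (f w))%:E : \bar R.
have F0 w : (0 <= F w)%E by rewrite lee_fin nsq_ge0.
have nf : norm2 f \is a fin_num by rewrite ge0_fin_numE ?norm2_ge0.
have [_ [X [finX _] <-] ltX] := ub_ereal_sup_adherent e0 nf.
exists (finmap.enum_fset (fset_set X)); first exact: finmap.fset_uniq.
have -> : norm2 (fun w =>
            f w - (if w \in finmap.enum_fset (fset_set X) then f w else 0)) =
          \esum_(w in ~` X) F w.
  rewrite [RHS]esum_mkcond; apply: eq_esum => w _.
  rewrite in_fset_set// in_setC; case: (w \in X) => /=; last by rewrite subr0.
  by rewrite subrr nsq0.
have split : norm2 f = (\esum_(w in X) F w + \esum_(w in ~` X) F w)%E.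
  by rewrite /norm2 (esumID X setT) ?setTI // => w _; exact: F0.
have {}ltX : (norm2 f - e%:E < \esum_(w in X) F w)%E by rewrite esum_fset.
have nX : \esum_(w in X) F w \is a fin_num.
  by move: nf; rewrite split fin_numD => /andP[].
by move: ltX; rewrite split lteBlDr// lteD2lE.
Qed.

End Norm.

(** * Linear spans and closed spans *)

Section Spans.
Context {T : choiceType}.
Implicit Types (A B : set (T -> C)) (f g h : T -> C).

Lemma lspan_sub A f : A f -> lspan A f.
Proof.
move=> Af; exists [:: (f, 1)]; split=> [p|]; first by rewrite inE => /eqP ->.
by apply/funext => w; rewrite big_seq1 mul1r.
Qed.

Lemma lspan0 A : lspan A (fun=> 0).
Proof. by exists [::]; split=> //; apply/funext => w; rewrite big_nil. Qed.

Lemma lspan_combo A (a : C) f g :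
  lspan A f -> lspan A g -> lspan A (fun w => a * f w + g w).
Proof.
move=> [s [As ->]] [t [At ->]].
exists ([seq (p.1, a * p.2) | p <- s] ++ t); split=> [p|].
  by rewrite mem_cat => /orP[/mapP[q /As ? ->]|/At].
apply/funext => w; rewrite big_cat big_map mulr_sumr /=; congr (_ + _).
by apply: eq_bigr => p _; rewrite mulrA.
Qed.

Lemma lspanZ A (a : C) f : lspan A f -> lspan A (fun w => a * f w).
Proof.
move=> Af; rewrite (_ : (fun w => _) = (fun w => a * f w + 0)).
  exact: lspan_combo Af (lspan0 _).
by apply/funext => w; rewrite addr0.
Qed.

Lemma lspan_sum {I : eqType} A (s : seq I) (c : I -> C) (F : I -> T -> C) :
  (forall i, i \in s -> lspan A (F i)) ->
  lspan A (fun w => \sum_(i <- s) c i * F i w).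
Proof.
elim: s => [|i s IHs] AF.
  rewrite (_ : (fun w => _) = (fun=> 0)); first exact: lspan0.
  by apply/funext => w; rewrite big_nil.
rewrite (_ : (fun w => _) = (fun w => c i * F i w + \sum_(i <- s) c i * F i w)).
  apply: lspan_combo; first by apply: AF; rewrite mem_head.
  by apply: IHs => j js; apply: AF; rewrite inE js orbT.
by apply/funext => w; rewrite big_cons.
Qed.

Lemma lspan_ind A (P : (T -> C) -> Prop) : P (fun=> 0) ->
  (forall a f g, A f -> P g -> P (fun w => a * f w + g w)) ->
  forall f, lspan A f -> P f.
Proof.
move=> P0 PD _ [s [As ->]]; elim: s As => [|p s IHs] As.
  rewrite (_ : (fun w => _) = (fun=> 0))//.
  by apply/funext => w; rewrite big_nil.
rewrite (_ : (fun w => _) =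
   (fun w => p.2 * p.1 w + \sum_(p <- s) p.2 * p.1 w)).
  apply: PD; first by apply: As; rewrite mem_head.
  by apply: IHs => q qs; apply: As; rewrite inE qs orbT.
by apply/funext => w; rewrite big_cons.
Qed.

Lemma lspan_min A B : A `<=` lspan B -> lspan A `<=` lspan B.
Proof.
move=> AB; apply: lspan_ind => [|a f g /AB]; first exact: lspan0.
exact: lspan_combo.
Qed.

Lemma eq_cspan A B : A `<=` lspan B -> B `<=` lspan A -> cspan A = cspan B.
Proof.
move=> AB BA; apply/seteqP; split=> g [l2g gA]; split=> // e e0;
have [h [Ah lt_e]] := gA e e0; exists h; split=> //.
- exact: lspan_min AB _ Ah.
- exact: lspan_min BA _ Ah.
Qed.

End Spans.
End SquareSummable.

(** * The finite levels of the tree *)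

Section Levels.
Context {N : nat}.
Local Notation word := (seq 'I_N).

Fixpoint level (n : nat) : seq word :=
  if n is n'.+1 then [seq i :: w | i <- enum 'I_N, w <- level n'] else [:: [::]].

Lemma mem_level n (w : word) : (w \in level n) = (size w == n).
Proof.
elim: n w => [|n IHn] [|i w] //=.
  by apply/negP => /allpairsP[[j v] [_ _]].
rewrite eqSS -IHn; apply/allpairsP/idP => [[[j v] /= [_ ? [_ ->]]]//|lw].
by exists (i, w); rewrite mem_enum.
Qed.

Lemma level_uniq n : uniq (level n).
Proof.
elim: n => //= n IHn; apply: allpairs_uniq => //; first exact: enum_uniq.
by move=> [i w] [j v] _ _ [-> ->].
Qed.

Lemma big_levelS (V : nmodType) n (F : word -> V) :
  \sum_(w <- level n.+1) F w = \sum_(i < N) \sum_(w <- level n) F (i :: w).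
Proof. by rewrite /= big_allpairs_dep big_enum. Qed.

(** Levels partition the words and each is finite, so infinite sums over the tree become series of
    finite sums. *)
Lemma esum_level (R : realType) (F : word -> R) : (forall w, 0 <= F w) ->
  \esum_(w in [set: word]) (F w)%:E =
  \esum_(n in [set: nat]) (\sum_(w <- level n) F w)%:E.
Proof.
move=> F0; pose J n : set word := [set` level n].
have -> : [set: word] = \bigcup_(n in [set: nat]) J n.
  apply/seteqP; split=> // w _; exists (size w) => //.
  by rewrite /J /= mem_level.
rewrite esum_bigcupT => [||w]; last by rewrite lee_fin.
  apply: eq_esum => n _; rewrite esum_fset => [||w _].
  - by rewrite -fsbig_seq ?level_uniq// sumEFin.
  - exact: finite_seq.
  - by rewrite lee_fin.
move=> i j _ _ [w] [] /=; rewrite /J /= !mem_level.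
by move=> /eqP <- /eqP <-.
Qed.

End Levels.

(** * Elementary tensors, and the orthonormal basis they form *)

Section Tensors.
Context {R : realType} {N : nat}.
Local Notation C := R[i].
Local Notation word := (seq 'I_N).
Local Notation vecH := (vecH R N).
Implicit Types (w : word) (vs : seq vecH) (v : vecH).

Lemma tens_size vs w : size w <> size vs -> tens vs w = 0.
Proof. by rewrite /tens; case: eqP. Qed.

Lemma tens_cons v vs i w : tens (v :: vs) (i :: w) = v i * tens vs w.
Proof.
rewrite /tens /= eqSS; case: ifP => _; last by rewrite mulr0.
by rewrite big_cons.
Qed.

Lemma tens_nil : tens [::] = @Omega R N.
Proof. by apply/funext => -[|i w]; rewrite /tens /Omega //= big_nil. Qed.

Lemma tens_nil1 : @tens R N [::] [::] = 1.
Proof. by rewrite tens_nil. Qed.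

Lemma tens_rcons v vs i w : tens (rcons vs v) (rcons w i) = tens vs w * v i.
Proof.
elim: vs w => [|u vs IHvs] [|j w].
- by rewrite /= tens_cons tens_nil1 mul1r mulr1.
- rewrite rcons_cons tens_cons !(tens_size (vs := [::])) ?mul0r ?mulr0//.
  by rewrite size_rcons.
- rewrite rcons_cons tens_cons !tens_size ?mul0r ?mulr0//.
  by rewrite size_rcons.
- by rewrite !rcons_cons !tens_cons IHvs mulrA.
Qed.

Lemma norm2_level (f : word -> C) :
  norm2 f = \esum_(n in [set: nat]) (\sum_(w <- level n) nsq (f w))%:E.
Proof. by apply: esum_level => w; exact: nsq_ge0. Qed.

(* Both parts of [rsum] sum the same level sums, so summability is irrelevant. *)
Lemma rsum_level0 (u : word -> R) :
  (forall n, \sum_(w <- level n) u w = 0) -> rsum u = 0.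
Proof.
move=> u0; apply/eqP; rewrite subr_eq0; apply/eqP; congr fine.
rewrite !esum_level; try by move=> w; rewrite le_max lexx orbT.
apply: eq_esum => n _; congr _%:E; apply/eqP.
rewrite -subr_eq0 -sumrB; apply/eqP; rewrite -[RHS](u0 n).
apply: eq_bigr => w _.
by case: (leP (u w) 0) => ?; case: (leP (- u w) 0) => ?; lra.
Qed.

Lemma inner_level0 (f g : word -> C) :
  (forall n, \sum_(w <- level n) f w * (g w)^* = 0) -> inner f g = 0.
Proof.
move=> fg0; rewrite /inner !rsum_level0// => n; rewrite -[RHS]/(0 : R).
  by rewrite -(raddf_sum (@complex.Im R)) fg0.
by rewrite -(raddf_sum (@complex.Re R)) fg0.
Qed.

Section Basis.
Variable x : 'I_N -> vecH.
Hypothesis x_on : forall a b, inner_H (x a) (x b) = (a == b)%:R.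

(** The inner product of two elementary tensors factors over their letters; the induction splits off
    the first one. *)
Lemma tens_orthonormal (u v : word) : size u = size v ->
  \sum_(w <- level (size u)) tens (map x u) w * (tens (map x v) w)^* = (u == v)%:R.
Proof.
elim: u v => [|a u IHu] [|b v]//.
  by rewrite big_seq1 tens_nil1 mul1r rmorph1.
move=> [suv]; rewrite -/(level (size u).+1) big_levelS.
under eq_bigr => i _ do under eq_bigr => w _ do
  rewrite !tens_cons rmorphM mulrACA.
under eq_bigr => i _ do rewrite -mulr_sumr IHu//.
rewrite -mulr_suml -/(inner_H (x a) (x b)) x_on eqseq_cons.
by rewrite -natrM mulnb.
Qed.

(** Orthonormality says that the square matrix of coordinates times its adjoint is the identity; a
    one-sided inverse of a square matrix is two-sided. *)
Lemma basis_complete (j k : 'I_N) : \sum_(a < N) (x a j)^* * x a k = (j == k)%:R.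
Proof.
pose M := \matrix_(a, i) x a i; pose M' := \matrix_(i, a) (x a i)^*.
have /mulmx1C /matrixP /(_ j k) : M *m M' = 1%:M.
  apply/matrixP => a b; rewrite !mxE -x_on /inner_H.
  by apply: eq_bigr => i _; rewrite !mxE.
by rewrite !mxE => <-; apply: eq_bigr => a _; rewrite !mxE.
Qed.

Lemma tens_complete (w w' : word) : size w = size w' ->
  \sum_(u <- level (size w)) (tens (map x u) w)^* * tens (map x u) w' = (w == w')%:R.
Proof.
elim: w w' => [|a w IHw] [|b w']//.
  by rewrite big_seq1 tens_nil1 mulr1 rmorph1.
move=> [sww]; rewrite -/(level (size w).+1) big_levelS.
under eq_bigr => i _ do under eq_bigr => u _ do
  rewrite /= !tens_cons rmorphM mulrACA.
under eq_bigr => i _ do rewrite -mulr_sumr IHw//.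
by rewrite -mulr_suml basis_complete eqseq_cons -natrM mulnb.
Qed.

(** Expands a point mass in finitely many basis tensors, which later gives density. For words of
    different lengths both sides vanish. *)
Lemma delta_tens (w w' : word) : 
  (w' == w)%:R = \sum_(u <- level (size w)) (tens (map x u) w)^* * tens (map x u) w'.
Proof.
have [sww|sww] := eqVneq (size w) (size w'); first by rewrite tens_complete// eq_sym.
rewrite big_seq big1 => [|u].
  by have [ww|//] := eqVneq w' w; rewrite ww eqxx in sww.
rewrite mem_level => /eqP su; rewrite (@tens_size _ w') ?mulr0//.
by rewrite size_map su; apply/eqP; rewrite eq_sym.
Qed.

End Basis.
End Tensors.

(** * Operators on sequences, and best approximation by multiples of a unit vector *)

Section Shifts.
Context {R : realType}.
Local Notation C := R[i].
Implicit Types y : nat -> C.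

Lemma l2_shiftS y : l2 y -> l2 (shiftS y).
Proof.
suff E : norm2 (shiftS y) = norm2 y by rewrite /l2 E.
rewrite /norm2 -(esum_image_eq (e := S)) => [||[|k]]//; first exact: succn_inj.
by move=> _; rewrite nsq0.
Qed.

Lemma l2_shiftSadj y : l2 y -> l2 (shiftSadj y).
Proof.
apply: le_lt_trans.
apply: (@esum_image_le _ _ _ S (fun k => (nsq (y k))%:E)); first exact: succn_inj.
by move=> k; rewrite lee_fin nsq_ge0.
Qed.

Lemma l2_Proj0 y : l2 y -> l2 (Proj0 y).
Proof.
apply: le_lt_trans; apply: le_esum => k _; rewrite /Proj0 lee_fin.
by case: eqP => [->|_]//; rewrite nsq0 nsq_ge0.
Qed.

Lemma l2_Dop N y : l2 y -> l2 (@Dop R N y).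
Proof.
move=> l2y; pose s : C := (Num.sqrt (N%:R : R))%:C.
rewrite (_ : Dop N y = (fun k => - s * shiftS y k +
  (- s * shiftSadj y k + N.+1%:R * y k))).
  apply: l2_combo; first exact: l2_shiftS.
  by apply: l2_combo; [exact: l2_shiftSadj|exact: l2Z].
by apply/funext => k; rewrite /Dop /ReS -/s; field.
Qed.

Lemma l2_DOmega N y : l2 y -> l2 (@DOmega R N y).
Proof.
move=> l2y; rewrite (_ : DOmega N y = (fun k => -1 * Proj0 y k + Dop N y k)).
  by apply: l2_combo; [exact: l2_Proj0|exact: l2_Dop].
by apply/funext => k; rewrite /DOmega; ring.
Qed.

Lemma l2_delta {T : choiceType} (t : T) : l2 (fun w => (w == t)%:R : C).
Proof.
pose a w : \bar R := (nsq ((w == t)%:R : C))%:E.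
rewrite /l2 /norm2 (_ : esum _ _ = \esum_(w in [set t]) a w).
  by rewrite esum_set1 ?ltry// lee_fin nsq_ge0.
rewrite [RHS]esum_mkcond; apply: eq_esum => w _; rewrite /a.
by rewrite in_set1; case: (w == t) => //=; rewrite nsq0.
Qed.

(* The residual [g - a b] is orthogonal to [b], so replacing [c] by the
   projection coefficient [a] lowers the sum by exactly [nsq (a - c)]. *)
Lemma projection_le {I : Type} (s : seq I) (g b : I -> C) (c : C) :
  \sum_(i <- s) b i * (b i)^* = 1 ->
  \sum_(i <- s) nsq (g i - (\sum_(j <- s) g j * (b j)^*) * b i) <=
  \sum_(i <- s) nsq (g i - c * b i).
Proof.
move=> b1; set a := \sum_(j <- s) g j * _; pose r i := g i - a * b i.
have rb : \sum_(i <- s) r i * (b i)^* = 0.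
  under eq_bigr do rewrite /r mulrBl -mulrA.
  by rewrite sumrB -mulr_sumr b1 mulr1 subrr.
have br : \sum_(i <- s) b i * (r i)^* = 0.
  have := congr1 Num.conj rb; rewrite rmorph_sum rmorph0; apply: etrans.
  apply: eq_bigr => i _.
  by rewrite rmorphM /= conjCK mulrC.
suff -> : \sum_(i <- s) nsq (g i - c * b i) =
          \sum_(i <- s) nsq (r i) + nsq (a - c) by rewrite lerDl nsq_ge0.
apply: complexI; rewrite rmorphD !rmorph_sum /= nsqE.
under eq_bigr do rewrite nsqE.
under [in RHS]eq_bigr do rewrite nsqE.
have E i : (g i - c * b i) * (g i - c * b i)^* = r i * (r i)^* +
   ((a - c)^* * (r i * (b i)^*) + ((a - c) * (b i * (r i)^*) +
     (a - c) * (a - c)^* * (b i * (b i)^*))).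
  have -> : g i - c * b i = r i + (a - c) * b i by rewrite /r; ring.
  set d := a - c; rewrite rmorphD rmorphM /=; ring.
under eq_bigr do rewrite E.
by rewrite !big_split -!mulr_sumr /= rb br b1 !mulr0 !add0r mulr1.
Qed.

End Shifts.

(** * The Laplacian at the root and away from it *)

Section Laplacian.
Context {R : realType} {N : nat}.
Local Notation C := R[i].
Local Notation word := (seq 'I_N).
Local Notation vecH := (vecH R N).
Implicit Types (f g : word -> C) (w : word).

Lemma Delta_combo (a : C) f g :
  Delta (fun w => a * f w + g w) = (fun w => a * Delta f w + Delta g w).
Proof.
apply/funext => w; rewrite /Delta mulrDr addrACA mulr_sumr -big_split /=.
congr (_ + _); first by apply: eq_bigr => i _; ring.
by case: w => [|i w]; ring.
Qed.

Lemma Delta0 : Delta (fun _ : word => 0 : C) = (fun=> 0).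
Proof.
apply/funext => w; rewrite /Delta subrr big1 ?add0r//.
by case: w.
Qed.

Lemma Delta_nil f : Delta f [::] = N%:R * f [::] - \sum_(i < N) f [:: i].
Proof. by rewrite /Delta addr0 sumrB sumr_const card_ord mulr_natl. Qed.

Lemma Delta_rcons f w j : Delta f (rcons w j) =
  N.+1%:R * f (rcons w j) - \sum_(i < N) f (rcons (rcons w j) i) - f w.
Proof.
rewrite /Delta /parent size_rcons /= -[X in take _ X]cats1 take_size_cat//.
rewrite sumrB sumr_const card_ord -mulr_natl -natr1.
have -> : (if rcons w j is [::] then 0 else f (rcons w j) - f w) =
          f (rcons w j) - f w by case: w.
by ring.
Qed.

End Laplacian.

(** * The Laplacian along one ray *)

Section Ray.
Context {R : realType} {N : nat}.
Hypothesis N_gt0 : (0 < N)%N.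
Local Notation C := R[i].
Local Notation word := (seq 'I_N).
Local Notation vecH := (vecH R N).
Local Notation s := ((Num.sqrt (N%:R : R))%:C).
Variable vs : seq vecH.
Let m := size vs.
Implicit Types (y z : nat -> C) (f g : word -> C) (w : word).

Definition ray_vec (p : nat) : word -> C := tens (vs ++ nseq p (@s0 R N)).

(* When [size w < size vs] the truncated subtraction gives [ray_vec 0 w], which
   vanishes. *)
Definition ray_synth y : word -> C :=
  fun w => y (size w - m)%N * ray_vec (size w - m) w.

(** The Fourier coefficient of [f] along [ray_vec p]. Since that vector lives on level [m + p], a
    finite sum suffices and [f] may be arbitrary. *)
Definition ray_coef f : nat -> C :=
  fun p => \sum_(w <- level (m + p)) f w * (ray_vec p w)^*.

(** Only the ray with empty [vs] meets the root of the tree, whose missing parent accounts for the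
    rank-one term of [DOmega]. *)
Definition ray_op y : nat -> C := if vs is [::] then DOmega N y else Dop N y.

Lemma ray_vec_size p w : size w <> (m + p)%N -> ray_vec p w = 0.
Proof. by move=> sw; apply: tens_size; rewrite size_cat size_nseq. Qed.

Lemma ray_synth_small y w : (size w < m)%N -> ray_synth y w = 0.
Proof.
move=> lt_m; rewrite /ray_synth (_ : size w - m = 0)%N; last first.
  by apply/eqP; rewrite subn_eq0 ltnW.
by rewrite ray_vec_size ?mulr0// addn0; apply/eqP; rewrite neq_ltn lt_m.
Qed.

Lemma ray_synth_level y p w : size w = (m + p)%N ->
  ray_synth y w = y p * ray_vec p w.
Proof. by move=> sw; rewrite /ray_synth sw addKn. Qed.

Lemma ray_synth_combo a y z :
  ray_synth (fun k => a * y k + z k) =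
  (fun w => a * ray_synth y w + ray_synth z w).
Proof. by apply/funext => w; rewrite /ray_synth mulrDl mulrA. Qed.

Lemma ray_synth_delta p : ray_synth (fun k => (k == p)%:R) = ray_vec p.
Proof.
apply/funext => w; rewrite /ray_synth; case: eqP => [->|np]; first by rewrite mul1r.
by rewrite mul0r ray_vec_size// => sw; apply: np; rewrite sw addKn.
Qed.

Lemma ray_synth0 : ray_synth (fun=> 0) = (fun=> 0).
Proof. by apply/funext => w; rewrite /ray_synth mul0r. Qed.

Lemma ray_vecS p w i : ray_vec p.+1 (rcons w i) = ray_vec p w * s^-1.
Proof.
rewrite /ray_vec -addn1 nseqD catA cats1 tens_rcons; congr (_ * _).
by rewrite /s0 rmorphV ?unitfE ?sqrtr_eq0 -?ltNge ?ltr0n.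
Qed.

Lemma sqrtN_neq0 : s != 0.
Proof.
by rewrite (inj_eq (@complexI R)) sqrtr_eq0 -ltNge ltr0n.
Qed.

Lemma sqrtN_sqr : s * s = N%:R.
Proof. by rewrite -rmorphM -expr2 sqr_sqrtr ?ler0n// rmorph_nat. Qed.

Lemma N_divs : N%:R / s = s.
Proof. by rewrite -sqrtN_sqr mulfK ?sqrtN_neq0. Qed.

(* That is, the last factor of [vs] is orthogonal to [s0], so the Laplacian does
   not lead below level [size vs]. *)
Hypothesis sum_last : forall us v, vs = rcons us v -> \sum_(i < N) v i = 0.

(** From level [m] on, each of the [N] children carries a factor [s^-1], and [N / s = s]. Above the
    ray's first level, both sides are zero. *)
Lemma ray_synth_children y w : \sum_(i < N) ray_synth y (rcons w i) =
  s * y (size w - m).+1 * ray_vec (size w - m) w.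
Proof.
case: (leqP m (size w)) => [le_m|lt_m].
  set p := (size w - m)%N; have sw : size w = (m + p)%N by rewrite subnKC.
  under eq_bigr => i _ do
    rewrite (@ray_synth_level _ p.+1) ?size_rcons ?sw ?addnS// ray_vecS.
  rewrite sumr_const card_ord -[LHS]mulr_natl -[in RHS]N_divs; ring.
have -> : ray_vec (size w - m) w = 0.
  have /eqP -> : (size w - m == 0)%N by rewrite subn_eq0 ltnW.
  by apply: ray_vec_size; rewrite addn0; apply/eqP; rewrite neq_ltn lt_m.
rewrite mulr0.
(* The critical case is level [m - 1]: its children lie on level [m], and their sum pairs the last
   factor of [vs] with a multiple of [s0]. *)
move: lt_m; rewrite leq_eqVlt => /orP[/eqP sw|lt_m]; last first.
  by apply: big1 => i _; rewrite ray_synth_small ?size_rcons.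
under eq_bigr => i _ do
  rewrite (@ray_synth_level _ 0) ?size_rcons ?addn0// /ray_vec /= cats0.
case/lastP Evs : vs => [|us v]; first by move: sw; rewrite /m Evs.
under eq_bigr do rewrite tens_rcons mulrA.
by rewrite -mulr_sumr (sum_last Evs) mulr0.
Qed.

(** The factor [s] undoes the [s^-1] gained by appending a letter. On level [m] the parent lies
    outside the ray, which matches the zero that [shiftS] inserts at index 0. *)
Lemma ray_synth_parent y w j : ray_synth y w =
  s * shiftS y (size (rcons w j) - m) * ray_vec (size (rcons w j) - m) (rcons w j).
Proof.
rewrite size_rcons; case: (leqP m (size w)) => [le_m|lt_m].
  by rewrite subSn//= ray_vecS /ray_synth; field; exact: sqrtN_neq0.
rewrite ray_synth_small// (_ : _ - m = 0)%N ?mulr0 ?mul0r//.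
by apply/eqP; rewrite subn_eq0.
Qed.

Lemma Delta_ray_synth y : Delta (ray_synth y) = ray_synth (ray_op y).
Proof.
apply/funext => w; case/lastP: w => [|w j].
  (* At the root the diagonal coefficient is [N], that is, [N.+1] less the contribution of [Proj0];
     for nonempty [vs] every term vanishes there. *)
  have [v0|vN0] := eqVneq vs [::].
    rewrite Delta_nil (ray_synth_children y [::]) sub0n /ray_synth /ray_op v0.
    by rewrite sub0n /DOmega /Dop /ReS /Proj0 /= /shiftSadj -natr1; field.
  have m_gt0 : (0 < m)%N by rewrite lt0n size_eq0.
  rewrite Delta_nil (ray_synth_children y [::]) !ray_synth_small//.
  rewrite ray_vec_size ?mulr0 ?subr0// sub0n addn0 => /eqP.
  by rewrite eq_sym -[_ == _]/(_ == 0%N) -leqn0 leqNgt m_gt0.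
rewrite Delta_rcons ray_synth_children (ray_synth_parent y w j).
set p := (size _ - m)%N; rewrite /ray_synth -/p /ray_op.
case Evs: vs => [|v us]; last by rewrite /Dop /ReS /shiftSadj; field.
have p_gt0 : p != 0%N by rewrite /p /m Evs size_rcons.
by rewrite /DOmega /Dop /ReS /shiftSadj /Proj0 (negPf p_gt0); field.
Qed.

Lemma l2_ray_op y : l2 y -> l2 (ray_op y).
Proof. by rewrite /ray_op; case: vs => [|_ _]; [exact: l2_DOmega|exact: l2_Dop]. Qed.

(** The Jacobi recurrence in a form that can be solved for [ray_vec p.+1], because the coefficient
    [- s] is nonzero. Cyclicity does not depend on the diagonal entry [a], so it stays
    existential. *)
Lemma Delta_ray_vec p : exists a : C, Delta (ray_vec p) = (fun w =>
  - s * ray_vec p.+1 w +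
  (a * ray_vec p w - s * (if p is q.+1 then ray_vec q w else 0))).
Proof.
pose d (q k : nat) : C := (k == q)%:R.
pose e (k : nat) : C := if p is q.+1 then d q k else 0.
pose a : C := if (vs == [::]) && (p == 0)%N then N%:R else N.+1%:R.
exists a; rewrite -ray_synth_delta Delta_ray_synth.
have -> : ray_op (d p) = (fun k => - s * d p.+1 k + (a * d p k + (- s * e k + 0))).
  have ES k : shiftS (d p) k = d p.+1 k by case: k => //= k; rewrite /d eqSS.
  have EA k : shiftSadj (d p) k = e k.
    by rewrite /e /shiftSadj /d; case: (p) => [|q]; rewrite ?eqSS.
  apply/funext => k; rewrite /ray_op /a; case: vs => [|v us] /=; last first.
    by rewrite /Dop /ReS ES EA; field.
  rewrite /DOmega /Dop /ReS ES EA /Proj0 /d; case: (p) => [|q] /=.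
    by case: eqP => [->|_] /=; rewrite -?natr1; field.
  by case: (k =P 0%N) => [->|_] /=; field.
rewrite !ray_synth_combo ray_synth0 !ray_synth_delta; apply/funext => w.
congr (_ + (_ + _)); rewrite addr0 mulNr; congr (- (_ * _)).
by rewrite /e; case: (p) => [|q]; rewrite ?ray_synth0 ?ray_synth_delta.
Qed.

Hypothesis ray_vec_unit : forall p,
  \sum_(w <- level (m + p)) ray_vec p w * (ray_vec p w)^* = 1.

Lemma ray_synthK : cancel ray_synth ray_coef.
Proof.
move=> y; apply/funext => p; rewrite /ray_coef -[RHS]mulr1 -(ray_vec_unit p).
rewrite mulr_sumr !big_seq; apply: eq_bigr => w; rewrite mem_level => /eqP sw.
by rewrite (ray_synth_level y sw) mulrA.
Qed.

(** Level [m + p] carries [y p] times a unit vector, and the levels before [m] carry nothing. *)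
Lemma norm2_ray_synth y : norm2 (ray_synth y) = norm2 y.
Proof.
rewrite norm2_level -(esum_image_eq (e := addn m)) => [|? ? /addnI//|n nm].
  apply: eq_esum => p _; congr _%:E; apply: complexI.
  rewrite rmorph_sum nsqE -[RHS]mulr1 -(ray_vec_unit p) mulr_sumr.
  rewrite !big_seq; apply: eq_bigr => w; rewrite mem_level => /eqP sw /=.
  by rewrite (ray_synth_level y sw) nsqM rmorphM /= !nsqE.
rewrite big_seq big1// => w; rewrite mem_level => /eqP sw.
rewrite ray_synth_small ?nsq0// sw ltnNge; apply/negP => le_m.
by apply: nm; exists (n - m)%N; rewrite ?subnKC.
Qed.

(** Best approximation holds on every level separately, so it holds for the sum, with no summability
    asked of [y]. *)
Lemma ray_projection_le g y :
  (norm2 (fun w => (g w - ray_synth (ray_coef g) w)%R) <=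
   norm2 (fun w => (g w - ray_synth y w)%R))%E.
Proof.
rewrite !norm2_level; apply: le_esum => n _; rewrite lee_fin.
case: (ltnP n m) => [lt_m|le_m].
  rewrite !big_seq; apply: ler_sum => w; rewrite mem_level => /eqP sw.
  by rewrite !ray_synth_small ?sw.
have := @projection_le _ _ (level (m + (n - m))%N) g (ray_vec (n - m))
  (y (n - m)%N) (ray_vec_unit (n - m)).
rewrite -/(ray_coef g (n - m)%N) subnKC//; apply: etrans.
by congr (_ <= _); rewrite !big_seq; apply: eq_bigr => w;
  rewrite mem_level => /eqP sw; rewrite (@ray_synth_level _ (n - m)%N) ?subnKC.
Qed.

Definition ray_space : set (word -> C) := cspan [set ray_vec p | p in [set: nat]].

Lemma lspan_ray_synth f :
  lspan [set ray_vec p | p in [set: nat]] f -> exists y, f = ray_synth y.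
Proof.
move: f; apply: lspan_ind => [|a f g [p _ <-] [y ->]].
  by exists (fun=> 0); rewrite ray_synth0.
by exists (fun k => a * (k == p)%:R + y k); rewrite ray_synth_combo ray_synth_delta.
Qed.

Lemma ray_spaceE : ray_space = [set ray_synth y | y in [set y | l2 y]].
Proof.
(* A member of the closed span is at least as close to its own projection as to any finite
   combination, so that distance is zero. Conversely, a synthesized [y] is approximated by
   truncating [y]. *)
apply/seteqP; split=> [g [l2g gV]|_ [y /= l2y <-]].
  suff E : ray_synth (ray_coef g) = g.
    by exists (ray_coef g) => //=; rewrite /l2 -norm2_ray_synth E.
  apply/funext => w; apply/esym/eqP; rewrite -subr_eq0; apply/eqP/nsq_eq0.
  apply/le_anti; rewrite nsq_ge0 andbT; apply/ler_addgt0Pr => e e0; rewrite add0r.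
  rewrite -lee_fin; have [h [/lspan_ray_synth[y ->] lt_e]] := gV e e0.
  apply: le_trans (norm2_pointwise (fun w => g w - ray_synth (ray_coef g) w) w) _.
  exact: le_trans (ray_projection_le g y) (ltW lt_e).
split=> [|e e0]; first by rewrite /l2 norm2_ray_synth.
have [t ut lt_e] := l2_finite_approx l2y e0.
exists (fun w => \sum_(p <- t) y p * ray_vec p w); split.
  by apply: lspan_sum => p _; apply: lspan_sub; exists p.
move: lt_e; rewrite -norm2_ray_synth; congr (norm2 _ < _)%E.
apply/funext => w; rewrite /ray_synth mulrBl; congr (_ - _).
(* At a given word only the index [k] can contribute to the finite sum. *)
set k := (size w - m)%N; have vec0 p : p != k -> ray_vec p w = 0.
  move=> /eqP npk; apply: ray_vec_size => sw; apply: npk.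
  by rewrite /k sw addKn.
case: ifP => kt; last first.
  rewrite mul0r big_seq big1// => p pt; rewrite vec0 ?mulr0//.
  by apply: contraFN kt => /eqP <-.
rewrite (bigD1_seq k)//= big1 ?addr0// => p /vec0 ->; exact: mulr0.
Qed.

Lemma ray_vec_in_space p : ray_space (ray_vec p).
Proof.
rewrite ray_spaceE -ray_synth_delta; exists (fun k => (k == p)%:R) => //.
exact: l2_delta.
Qed.

Lemma ray_unit_equiv : unit_equiv_restr (@WDeltaW R N) ray_space ray_op.
Proof.
exists ray_coef; split=> [f|a f g _ _|y l2y|f].
- by rewrite ray_spaceE => -[y l2y <-]; rewrite ray_synthK norm2_ray_synth.
- apply/funext => p; rewrite /ray_coef mulr_sumr -big_split /=.
  by apply: eq_bigr => w _; rewrite mulrDl mulrA.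
- by exists (ray_synth y); rewrite ?ray_synthK// ray_spaceE; exists y.
rewrite ray_spaceE => -[y l2y <-].
rewrite -[WDeltaW _]/(Delta (ray_synth y)) Delta_ray_synth !ray_synthK; split=> //.
by exists (ray_op y) => //; exact: l2_ray_op.
Qed.

(** The bottom vector is cyclic: its iterates and the vectors of the ray have the same finite linear
    span, hence the same closed span. *)
Lemma ray_cyclic : cyclic_subspace (@WDeltaW R N) ray_space.
Proof.
exists (ray_vec 0); split; first exact: ray_vec_in_space.
pose K := [set iter k (@WDeltaW R N) (ray_vec 0) | k in [set: nat]].
have K_stable f : lspan K f -> lspan K (Delta f).
  move: f; apply: lspan_ind => [|a f g [k _ <-] Kg].
    by rewrite Delta0; exact: lspan0.
  rewrite Delta_combo; apply: lspan_combo => //; apply: lspan_sub.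
  by exists k.+1.
apply: eq_cspan => [_ [p _ <-]|_ [k _ <-]].
  (* The recurrence solved for its highest vector; at [q = 0] the lower neighbour is zero. *)
  have step q : lspan K (ray_vec q) ->
      lspan K (fun w => if q is r.+1 then ray_vec r w else 0) ->
      lspan K (ray_vec q.+1).
    move=> Kq Kr; have [a Ea] := Delta_ray_vec q.
    rewrite (_ : ray_vec q.+1 = (fun w => - s^-1 * Delta (ray_vec q) w +
      (a / s * ray_vec q w + -1 * (if q is r.+1 then ray_vec r w else 0)))).
      apply: lspan_combo; first exact: K_stable.
      by apply: lspan_combo => //; exact: lspanZ.
    apply/funext => w; rewrite Ea; case: (q) => [|r]; field; exact: sqrtN_neq0.
  (* A three-term recurrence needs two consecutive vectors in the induction. *)
  suff : lspan K (ray_vec p) /\ lspan K (ray_vec p.+1) by case.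
  elim: p => [|p [Kp KSp]].
    have K0 : lspan K (ray_vec 0) by apply: lspan_sub; exists 0%N.
    by split=> //; apply: step => //; exact: lspan0.
  by split=> //; exact: step.
elim: k => [|k IHk]; first by apply: lspan_sub; exists 0%N.
move: IHk => /=; set f := iter _ _ _; rewrite -[WDeltaW f]/(Delta f); move: f.
apply: lspan_ind => [|a f g [p _ <-] Kg]; first by rewrite Delta0; exact: lspan0.
have vecP q : lspan [set ray_vec p | p in [set: nat]] (ray_vec q).
  by apply: lspan_sub; exists q.
rewrite Delta_combo; apply: lspan_combo => //; have [c ->] := Delta_ray_vec p.
rewrite (_ : (fun w => _) = (fun w => - s * ray_vec p.+1 w + (c * ray_vec p w +
  - s * (if p is q.+1 then ray_vec q w else 0)))); last first.
  by apply/funext => w; rewrite !mulNr.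
apply: lspan_combo => //; apply: lspan_combo => //; apply: lspanZ.
by case: (p) => [|q]; [exact: lspan0|exact: vecP].
Qed.

End Ray.

(** * Unique splitting of a word into a root and a tail of [i1] *)

Section Words.
Context {T : eqType} (i1 : T).
Implicit Types u ws : seq T.

Definition ray_root ws := ws == [::] \/ (ws != [::] /\ last i1 ws != i1).

Lemma ray_root_rcons ws a : ray_root (rcons ws a) -> a != i1.
Proof. by case=> [|[_]]; rewrite ?last_rcons//; case: ws. Qed.

Lemma nseq_rcons p (a : T) : nseq p.+1 a = rcons (nseq p a) a.
Proof. by rewrite -addn1 nseqD cats1. Qed.

Lemma ray_decomp u : exists2 ws, ray_root ws & exists p, u = ws ++ nseq p i1.
Proof.
elim/last_ind: u => [|u a [ws rws [p ->]]].
  by exists [::]; [left|exists 0%N].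
have [->|a1] := eqVneq a i1.
  by exists ws => //; exists p.+1; rewrite nseq_rcons rcons_cat.
exists (rcons (ws ++ nseq p i1) a); last by exists 0%N; rewrite cats0.
by right; rewrite last_rcons; split=> //; case: (ws ++ _).
Qed.

(** Trailing letters [i1] are removed from both sides in step; if one tail ended first, its root
    would end in [i1]. *)
Lemma ray_decomp_inj ws ws' p q : ray_root ws -> ray_root ws' ->
  ws ++ nseq p i1 = ws' ++ nseq q i1 -> ws = ws'.
Proof.
move=> rws rws'; elim: p q => [|p IHp] [|q]; rewrite ?cats0//.
- rewrite nseq_rcons -rcons_cat => E; move: rws; rewrite E.
  by move=> /ray_root_rcons; rewrite eqxx.
- rewrite nseq_rcons -rcons_cat => E; move: rws'; rewrite -E.
  by move=> /ray_root_rcons; rewrite eqxx.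
by rewrite !nseq_rcons -!rcons_cat => /rcons_inj[] /IHp.
Qed.

End Words.

Lemma H_OmegaE (R : realType) (N : nat) : @H_Omega R N = ray_space [::].
Proof.
rewrite /H_Omega /ray_space; congr cspan; apply/seteqP; split=> f.
  by case=> [->|[p p_gt0 <-]]; [exists 0%N => //; rewrite -tens_nil|exists p].
case=> -[|p] _ <-; last by right; exists p.+1.
by left; rewrite /ray_vec tens_nil.
Qed.

(** * Orthogonality and completeness of the family of rays *)

Section OrthonormalRays.
Context {R : realType} {N : nat} (hN : (0 < N)%N) (x : 'I_N -> vecH R N).
Hypothesis x_on : forall a b : 'I_N, inner_H (x a) (x b) = (a == b)%:R.
Local Notation i1 := (Ordinal hN).
Hypothesis x_i1 : x i1 = @s0 R N.
Implicit Types ws : seq 'I_N.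

Lemma ray_vec_tens ws p : ray_vec (map x ws) p = tens (map x (ws ++ nseq p i1)).
Proof. by rewrite map_cat map_nseq x_i1. Qed.

Lemma ray_vec_orthonormal ws p : let m := size (map x ws) in
  \sum_(w <- level (m + p)) ray_vec (map x ws) p w * (ray_vec (map x ws) p w)^* = 1.
Proof.
rewrite /= ray_vec_tens size_map.
have := tens_orthonormal x_on (erefl (size (ws ++ nseq p i1))).
by rewrite eqxx size_cat size_nseq.
Qed.

(** Pairing with [s0] is the coordinate sum divided by the square root of [N], and [x a] is
    orthogonal to [x i1], which is [s0]. *)
Lemma sum_basis_vec (a : 'I_N) : a != i1 -> \sum_(i < N) x a i = 0.
Proof.
move=> a1; have := x_on a i1; rewrite (negPf a1) x_i1 /inner_H -mulr_suml.
move=> /eqP; rewrite mulf_eq0 => /orP[/eqP //|].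
by rewrite eq_complex /= invr_eq0 sqrtr_eq0 leNgt ltr0n hN.
Qed.

Lemma ray_root_sum_last ws : ray_root i1 ws ->
  forall us v, map x ws = rcons us v -> \sum_(i < N) v i = 0.
Proof.
case/lastP: ws => [|ws a] rws us v; first by case: us.
rewrite map_rcons => /rcons_inj[_ <-]; apply: sum_basis_vec.
exact: ray_root_rcons rws.
Qed.

(** On each level [f] and [g] are multiples of single basis tensors or zero. Different roots give
    different words, so each level sum vanishes. *)
Lemma ray_spaces_orthogonal ws ws' f g : ray_root i1 ws -> ray_root i1 ws' ->
  ws <> ws' -> ray_space (map x ws) f -> ray_space (map x ws') g -> inner f g = 0.
Proof.
move=> rws rws' neq; rewrite !ray_spaceE; try exact: ray_vec_orthonormal.
move=> [y _ <-] [z _ <-]; apply: inner_level0 => n.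
case: (ltnP n (size (map x ws))) => [lt_n|le_n].
  rewrite big_seq big1// => w; rewrite mem_level => /eqP sw.
  by rewrite ray_synth_small ?sw ?mul0r.
case: (ltnP n (size (map x ws'))) => [lt_n'|le_n'].
  rewrite big_seq big1// => w; rewrite mem_level => /eqP sw.
  by rewrite [X in _ * X^*]ray_synth_small ?sw ?rmorph0 ?mulr0.
move: le_n le_n'; rewrite !size_map => le_n le_n'.
pose p := (n - size ws)%N; pose q := (n - size ws')%N.
pose u := ws ++ nseq p i1; pose v := ws' ++ nseq q i1.
have su : size u = n by rewrite size_cat size_nseq subnKC.
have sv : size v = n by rewrite size_cat size_nseq subnKC.
have uv : u != v by apply/eqP => /(ray_decomp_inj rws rws').
have := tens_orthonormal x_on (etrans su (esym sv)).
rewrite su (negPf uv) => /(congr1 (fun c => y p * (z q)^* * c)).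
rewrite mulr0 mulr_sumr; apply: etrans; rewrite !big_seq; apply: eq_bigr => w.
rewrite mem_level => /eqP sw; rewrite /ray_synth !size_map sw !ray_vec_tens.
by rewrite rmorphM mulrACA.
Qed.

(** Finitely supported functions are dense; they are finite combinations of basis tensors, each of
    which lies on one ray. *)
Lemma ray_spaces_complete :
  cspan (fun h => exists ws, ray_root i1 ws /\ ray_space (map x ws) h) =
  [set f | l2 f].
Proof.
apply/seteqP; split=> [f []//|f l2f]; split=> // e e0.
have [t ut lt_e] := l2_finite_approx l2f e0.
exists (fun w => \sum_(v <- t) f v * (w == v)%:R); split.
  apply: lspan_sum => v _; rewrite [X in lspan _ X](funext (delta_tens x_on v)).
  apply: lspan_sum => u _; apply: lspan_sub.
  have [ws rws [p ->]] := ray_decomp i1 u; exists ws; split=> //.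
  by rewrite -ray_vec_tens; apply: ray_vec_in_space; exact: ray_vec_orthonormal.
move: lt_e; congr (norm2 _ < _)%E; apply/funext => w; congr (_ - _).
case: ifPn => wt.
  rewrite (bigD1_seq w)//= eqxx mulr1 big1 ?addr0// => v vw.
  by rewrite eq_sym (negPf vw) mulr0.
rewrite big_seq big1// => v vt; case: eqP => [E|_]; last by rewrite mulr0.
by rewrite E vt in wt.
Qed.

End OrthonormalRays.

Theorem theorem3p16 (R : realType) (N : nat) (hN : (0 < N)%N)
  (x : 'I_N -> vecH R N)
  (hxon : forall a b : 'I_N, inner_H (x a) (x b) = (a == b)%:R)
  (hx1 : x (Ordinal hN) = @s0 R N) :
  let i1 := Ordinal hN in
  let valid (ws : seq 'I_N) := ws != [::] /\ last i1 ws != i1 in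
  let Hs (ws : seq 'I_N) := if ws == [::] then @H_Omega R N else H_idx x ws in
  (* (i) mutual orthogonality *)
  [/\ (forall ws ws', (ws == [::] \/ valid ws) -> (ws' == [::] \/ valid ws') ->
         ws <> ws' -> forall f g, Hs ws f -> Hs ws' g -> inner f g = 0),
      (* the orthogonal sum is all of F *)
      cspan (fun h => exists ws, (ws == [::] \/ valid ws) /\ Hs ws h)
        = [set f | l2 f],
      (* each summand is cyclic for W Delta W^* *)
      (forall ws, (ws == [::] \/ valid ws) -> cyclic_subspace (@WDeltaW R N) (Hs ws)),
  (* (ii) unitary equivalences *)
      unit_equiv_restr (@WDeltaW R N) (@H_Omega R N) (@DOmega R N)
    & forall ws, valid ws -> unit_equiv_restr (@WDeltaW R N) (H_idx x ws) (@Dop R N)].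
Proof.
move=> i1 valid Hs.
(* Both kinds of summand are ray spaces, the empty word giving [H_Omega]. *)
have HsE ws : Hs ws = ray_space (map x ws).
  by rewrite /Hs; case: eqP => [->|_]//; exact: H_OmegaE.
have unit_vec := ray_vec_orthonormal hxon hx1.
split=> [ws ws' rws rws' neq f g||ws rws||ws [ws0 lastw]].
- by rewrite !HsE; exact: (ray_spaces_orthogonal hxon hx1).
- rewrite -(ray_spaces_complete hxon hx1); congr cspan; apply/funext => h.
  by apply/propext; split=> -[ws []]; [rewrite HsE|rewrite -HsE]; exists ws.
- rewrite HsE; apply: ray_cyclic => //.
  exact: ray_root_sum_last hxon hx1 _ rws.
- rewrite H_OmegaE; apply: (@ray_unit_equiv _ _ hN [::]) => [[]//|].
  exact: (unit_vec [::]).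
(* Exposing the first letter of [ws] lets [ray_op] reduce to [Dop]. *)
- have := @ray_unit_equiv _ _ hN (map x ws); case: ws ws0 lastw => // a ws _ lastw.
  apply; last exact: (unit_vec (a :: ws)).
  by apply: ray_root_sum_last hxon hx1 _ _; right.
Qed.
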